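(* Let $G$ be a vertex-transitive nut graph on $n$ vertices, of degree $d$ (every vertex of $G$ has exactly $d$ neighbours). Then $n$ and $d$ satisfy the following conditions. Either $d \equiv 0 \pmod 4$, and $n \equiv 0 \pmod 2$, and $n \geq d+4$; or $d \equiv 2 \pmod 4$, and $n \equiv 0 \pmod 4$, and $n \geq d+6$.
   Context: All graphs are finite and simple (no loops, no multiple edges). For a graph $G$ on $n$ vertices, $\mathbf{A}(G)$ denotes its $n \times n$ $0$-$1$ adjacency matrix. A nut graph is a graph $G$ with $n>1$ vertices such that the kernel of $\mathbf{A}(G)$ (over $\mathbb{R}$) is one-dimensional and is spanned by a vector with no zero entries. (The single isolated vertex, the trivial case, is not counted as a nut graph.) A graph $G$ is vertex-transitive if its automorphism group $\operatorname{Aut}(G)$ acts transitively on its vertices. *)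

(* Defs.v *)
From HB Require Import structures.
From mathcomp Require Import all_boot all_order all_algebra all_fingroup.
From mathcomp Require Import reals.
Set Implicit Arguments.
Unset Strict Implicit.
Unset Printing Implicit Defensive.

Record sgraph := SGraph {
  vertex :> finType;
  adj : rel vertex;
  adj_sym : symmetric adj;
  adj_irrefl : irreflexive adj }.

Definition neighbours (G : sgraph) (x : G) : {set G} := [set y | adj x y].

Definition regular (G : sgraph) (d : nat) : Prop :=
  forall x : G, #|neighbours x| = d.

Section Automorphisms.
Variable G : sgraph.

Definition graph_aut : {set {perm G}} :=
  [set s : {perm G} | [forall x, forall y, adj (s x) (s y) == adj x y]].

Lemma graph_aut_group_set : group_set graph_aut.
Proof.
apply/group_setP; split.
  by rewrite inE; apply/forallP=> x; apply/forallP=> y; rewrite !perm1.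
move=> s t; rewrite !inE => /forallP hs /forallP ht.
apply/forallP=> x; apply/forallP=> y; rewrite !permM.
by rewrite (eqP (forallP (ht _) _)) (eqP (forallP (hs _) _)).
Qed.

Canonical graph_aut_group := Group graph_aut_group_set.
End Automorphisms.

Definition vertex_transitive (G : sgraph) : Prop :=
  [transitive graph_aut G, on [set: G] | 'P].

Section Adjacency.
Import GRing.Theory.
Local Open Scope ring_scope.

(* The vertices are numbered by the canonical enumeration of G. *)
Definition adjmx (R : realType) (G : sgraph) : 'M[R]_#|G| :=
  \matrix_(i, j) (adj (enum_val i) (enum_val j))%:R.

Lemma adjmx_sym (R : realType) (G : sgraph) : (adjmx R G)^T = adjmx R G.
Proof. by apply/matrixP=> i j; rewrite !mxE adj_sym. Qed.

(* kermx A represents {u | u *m A = 0}; since A(G) is symmetric (adjmx_sym),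
   this is the usual kernel {x | A(G) *m x = 0}, written with row vectors. *)
Definition nut_graph (R : realType) (G : sgraph) : Prop :=
  [/\ (1 < #|G|)%N,
      \rank (kermx (adjmx R G)) = 1%N
    & exists2 v : 'rV[R]_#|G|,
        (kermx (adjmx R G) == v)%MS & forall i, v 0 i != 0].
End Adjacency.

(* Main.v *)
(** The kernel of the adjacency matrix is a line, so an automorphism multiplies
    a kernel vector [f] by a scalar, which has absolute value 1 because the
    automorphism preserves the sum of the absolute values of the entries.  By
    transitivity the entries of [f] are [± a]: they split the vertices into two
    halves such that every vertex has [d / 2] neighbours in each.  Double
    counting the edges across shows that the halves have the same size, and the
    handshake lemma in one half gives the congruences.  Finally [n = d + 2]
    would give two vertices with the same neighbours, and their difference
    would be a kernel vector supported on two vertices. *)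
Require Import Defs.
From mathcomp Require Import all_boot all_order all_algebra all_fingroup.
From mathcomp Require Import reals zify.
Set Implicit Arguments.
Unset Strict Implicit.
Unset Printing Implicit Defensive.
Import Order.TTheory GRing.Theory Num.Theory.

Section Counting.
Variable G : sgraph.
Implicit Types (x y : G) (S T : {set G}).

Lemma card_neighboursI x S : #|neighbours x :&: S| = \sum_(y in S) adj x y.
Proof.
rewrite -sum1_card big_mkcond /= [RHS]big_mkcond /=.
by apply: eq_bigr => y _; rewrite !inE; case: (adj x y); case: (y \in S).
Qed.

Lemma edge_count_sym S T :
  \sum_(x in S) #|neighbours x :&: T| = \sum_(y in T) #|neighbours y :&: S|.
Proof.
under eq_bigr do rewrite card_neighboursI.
rewrite exchange_big; apply: eq_bigr => y _.
by rewrite card_neighboursI; apply: eq_bigr => x _; rewrite adj_sym.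
Qed.

(** The vertex order [lt] splits the ordered adjacent pairs in [S] into two classes that swapping
    exchanges, so the sum is a double; irreflexivity excludes the diagonal. *)
Lemma handshake S : ~~ odd (\sum_(x in S) #|neighbours x :&: S|).
Proof.
pose lt x y := (enum_rank x < enum_rank y)%N.
have E : \sum_(x in S) #|neighbours x :&: S| =
    \sum_(x in S) \sum_(y in S) (adj x y && lt x y) +
    \sum_(x in S) \sum_(y in S) (adj x y && lt y x).
  rewrite -big_split; apply: eq_bigr => x _ /=.
  rewrite card_neighboursI -big_split; apply: eq_bigr => y _ /=.
  rewrite /lt; case: ltngtP => [||/val_inj/enum_rank_inj ->].
  - by case: (adj x y).
  - by case: (adj x y).
  - by rewrite adj_irrefl.
rewrite E exchange_big /=.
under eq_bigr do under eq_bigr do rewrite adj_sym.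
by rewrite addnn odd_double.
Qed.

Lemma regular_lt (d : nat) x : regular G d -> (d < #|G|)%N.
Proof.
move=> /(_ x) <-; rewrite -cardsT; apply: proper_card.
by apply/properP; split; [apply: subsetT | exists x; rewrite !inE ?adj_irrefl].
Qed.

(** Only one vertex [y] besides [x] itself lies outside [neighbours x]. The neighbours of [y] avoid
    [x] and [y], hence lie in [neighbours x], and the degrees agree. *)
Lemma regular_twins (d : nat) x :
  regular G d -> #|G| = (d + 2)%N ->
  exists2 y, x != y & forall z, adj z x = adj z y.
Proof.
move=> reg cG.
have xN : x \in ~: neighbours x by rewrite !inE adj_irrefl.
have : #|~: neighbours x :\ x| = 1%N.
  by have := cardsD1 x (~: neighbours x); rewrite xN cardsCs setCK reg cG; lia.
move=> /eqP/cards1P[y Ey].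
have : y \in ~: neighbours x :\ x by rewrite Ey set11.
rewrite !inE => /andP[yx nxy].
have : neighbours y = neighbours x.
  apply/eqP; rewrite eqEcard !reg leqnn andbT; apply/subsetP => z.
  rewrite !inE => ayz; apply: contraT => nxz.
  have : z \in ~: neighbours x :\ x.
    rewrite !inE nxz andbT; apply: contraNneq nxy => <-.
    by rewrite adj_sym.
  by rewrite Ey inE => /eqP zy; rewrite zy adj_irrefl in ayz.
move=> /setP Nyx; exists y; first by rewrite eq_sym.
by move=> z; have := Nyx z; rewrite !inE ![adj z _]adj_sym => ->.
Qed.

End Counting.

Section Kernel.
Local Open Scope ring_scope.
Variables (R : realType) (G : sgraph).
Implicit Types f g : G -> R.

(** Functions on vertices, unlike row vectors, compose directly with automorphisms. *)
Definition in_kernel f := forall x, \sum_(y in neighbours x) f y = 0.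

Lemma in_kernelP f :
  in_kernel f <-> (\row_i f (enum_val i) <= kermx (adjmx R G))%MS.
Proof.
have E x : ((\row_i f (enum_val i)) *m adjmx R G) 0 (enum_rank x) =
    \sum_(y in neighbours x) f y.
  rewrite !mxE [RHS]big_mkcond (reindex (@enum_val G G)) /=; last first.
    by apply: onW_bij; apply: enum_val_bij.
  apply: eq_bigr => i _; rewrite !mxE enum_rankK inE adj_sym.
  by case: adj; rewrite ?mulr1 ?mulr0.
split=> [kf|/sub_kermxP kf x]; last by rewrite -E kf mxE.
apply/sub_kermxP/rowP => i; rewrite -[i]enum_valK E mxE; exact: kf.
Qed.

Lemma nut_kernel : nut_graph R G ->
  exists f, [/\ forall x, f x != 0, in_kernel f
    & forall g, in_kernel g -> exists c, forall x, g x = c * f x].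
Proof.
case=> _ _ [v /eqmxP kv v0]; exists (fun x => v 0 (enum_rank x)); split=> //.
  apply/in_kernelP; rewrite kv; suff -> : \row_i v 0 (enum_rank (enum_val i)) = v by [].
  by apply/rowP => i; rewrite mxE enum_valK.
move=> g /in_kernelP; rewrite kv => /sub_rVP[c /rowP gc].
by exists c => x; have := gc (enum_rank x); rewrite !mxE enum_rankK.
Qed.

Lemma nut_full_support g (x y : G) :
  nut_graph R G -> in_kernel g -> g x != 0 -> g y != 0.
Proof.
move=> /nut_kernel[f [f0 _ fP]] /fP[c gE]; rewrite !gE !mulf_eq0 !negb_or.
by case/andP=> -> _ /=.
Qed.

(** Since [s] maps [neighbours x] onto [neighbours (s x)], the sum of [f \o s] at [x] is that of [f]
    at [s x]. *)
Lemma in_kernel_aut f (s : {perm G}) :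
  s \in graph_aut G -> in_kernel f -> in_kernel (f \o s).
Proof.
rewrite inE => /forallP autP kf x; rewrite -[RHS](kf (s x)).
rewrite [RHS](reindex_inj (@perm_inj _ s)); apply: eq_bigl => y.
by rewrite !inE (eqP (forallP (autP x) y)).
Qed.

Lemma nut_norm_const : nut_graph R G -> vertex_transitive G ->
  exists f, [/\ forall x, f x != 0, in_kernel f & forall x y, `|f x| = `|f y|].
Proof.
move=> /nut_kernel[f [f0 kf fP]] tr; exists f; split=> // x y.
have [s sA ->] := atransP2 tr (in_setT x) (in_setT y).
have [c cE] := fP _ (in_kernel_aut sA kf).
have S0 : 0 < \sum_z `|f z|.
  by rewrite (bigD1 x) //= ltr_pwDl ?normr_gt0 ?f0 // sumr_ge0.
have : `|c| * \sum_z `|f z| = 1 * \sum_z `|f z|.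
  rewrite mul1r [RHS](reindex_inj (@perm_inj _ s)) mulr_sumr.
  by apply: eq_bigr => z _; rewrite -normrM -cE.
move=> /(mulIf (lt0r_neq0 S0)) c1.
by have := cE x; rewrite /= => ->; rewrite normrM c1 mul1r.
Qed.

Lemma nut_balanced : nut_graph R G -> vertex_transitive G ->
  exists S : {set G}, forall x, #|neighbours x :&: S| = #|neighbours x :&: ~: S|.
Proof.
move=> nutG tr; have [f [f0 kf fn]] := nut_norm_const nutG tr.
(* With all entries equal to plus or minus [|f x|], the kernel equation at [x] says that positive
   and negative neighbours are equally many. *)
exists [set x | 0 < f x] => x; have a0 : `|f x| != 0 by rewrite normr_eq0.
have := kf x; rewrite (big_setID [set y | 0 < f y]) /= setDE.
rewrite (eq_bigr (fun=> `|f x|)); last first.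
  by move=> y; rewrite !inE => /andP[_ fy]; rewrite (fn x y) gtr0_norm.
rewrite [X in _ + X](eq_bigr (fun=> - `|f x|)); last first.
  move=> y; rewrite !inE -leNgt => /andP[_ fy].
  by rewrite (fn x y) ler0_norm // opprK.
by rewrite !sumr_const mulNrn => /subr0_eq /(mulrIn a0).
Qed.

(** Without edges, the indicator of a single vertex would be in the kernel, yet it vanishes at any
    other vertex. *)
Lemma nut_degree_gt0 (d : nat) : nut_graph R G -> regular G d -> (0 < d)%N.
Proof.
move=> nutG reg; rewrite lt0n; apply/eqP => d0.
have : (1 < #|G|)%N by case: nutG.
case/card_gt1P => x [y [_ _ xy]].
have /(nut_full_support y nutG) : in_kernel (fun z => (z == x)%:R).
  by move=> z; move: (reg z); rewrite d0 => /cards0_eq ->; rewrite big_set0.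
by move/(_ x); rewrite eqxx oner_eq0 [y == x]eq_sym (negPf xy) eqxx => /(_ isT).
Qed.

Lemma nut_no_twins (x y z : G) : nut_graph R G ->
  (forall t, adj t x = adj t y) -> x != y -> ~~ adj x z.
Proof.
move=> nutG tw xy; apply/negP => xz.
have sumE (t u : G) : \sum_(w in neighbours t) (w == u)%:R = (adj t u)%:R :> R.
  rewrite big_mkcond (bigD1 u) //= inE eqxx big1 => [|w /negPf->]; last first.
    by case: ifP.
  by rewrite addr0; case: adj.
(* The neighbour [z] is a third vertex, where the difference of the indicators of [x] and [y]
   vanishes. *)
have zx : z == x = false by apply: contraTF xz => /eqP ->; rewrite adj_irrefl.
have zy : z == y = false.
  by apply: contraTF xz => /eqP ->; rewrite -tw adj_irrefl.
have /(nut_full_support z nutG) : in_kernel (fun w => (w == x)%:R - (w == y)%:R).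
  by move=> t; rewrite sumrB !sumE tw subrr.
by move/(_ x); rewrite eqxx (negPf xy) zx zy subr0 subrr oner_eq0 eqxx => /(_ isT).
Qed.
End Kernel.

Theorem theorem5 (R : realType) (G : sgraph) (n d : nat) :
  #|G| = n ->
  nut_graph R G ->
  vertex_transitive G ->
  regular G d ->
  [/\ d = 0 %[mod 4], n = 0 %[mod 2] & d + 4 <= n] \/
  [/\ d = 2 %[mod 4], n = 0 %[mod 4] & d + 6 <= n].
Proof.
move=> cG nutG tr reg.
have d_gt0 := nut_degree_gt0 nutG reg.
have [x _] : exists x, x \in [set: G].
  by apply/set0Pn; rewrite -card_gt0 cardsT; case: nutG => /ltnW.
have d_lt_n : d < n by rewrite -cG (regular_lt x).
have n_neq : n <> d + 2.
  rewrite -cG => /(regular_twins x reg)[y xy tw].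
  have [z] : exists z, z \in neighbours x.
    by apply/set0Pn; rewrite -card_gt0 reg.
  by rewrite inE (negPf (nut_no_twins z nutG tw xy)).
have [S bal] := nut_balanced nutG tr.
have degE y : (#|neighbours y :&: S|).*2 = d.
  by rewrite -addnn {2}bal -setDE cardsID reg.
have halfE y : #|neighbours y :&: S| = d./2 by rewrite -(degE y) doubleK.
have halfCE y : #|neighbours y :&: ~: S| = d./2 by rewrite -bal halfE.
have dE : d = (d./2).*2 by rewrite -{1}(degE x) halfE.
have eqS : #|S| = #|~: S|.
  have := edge_count_sym S (~: S).
  under eq_bigr do rewrite halfCE.
  under [RHS]eq_bigr do rewrite halfE.
  (* Cancelling [d./2] is allowed because [d] is even and positive. *)
  by rewrite !sum_nat_const => /eqP; rewrite eqn_pmul2r => [/eqP|]; lia.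
have nE : n = (#|S|).*2 by rewrite -cG -(cardsC S) -eqS addnn.
have := handshake S; under eq_bigr do rewrite halfE.
rewrite sum_nat_const oddM negb_and.
(* The product of [#|S|] and [d./2] is even. If [d./2] is odd, then [#|S|] is even and 4 divides
   [n], so [n - d] is 2 modulo 4; being neither 0 nor 2, it is at least 6. Otherwise [n - d] is
   even, positive and not 2. *)
case: (boolP (odd d./2)) => [odd_half /orP[] // even_S | even_half _].
  by right; split; lia.
by left; split; lia.
Qed.
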